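(* Let $L$ be a finite-dimensional $n$-step nilpotent Lie superalgebra over a field $\mathbb{F}$ with $n>3$. If $[L^{n-3},L^1]\neq 0$, then there exists a non-trivial superderivation $D\in\operatorname{Der}(L)$ of $L$ such that $D(L^1)\subseteq Z(L)$. Furthermore, (under the same hypothesis $[L^{n-3},L^1]\neq 0$) $L$ admits pure local superderivations, i.e. there exists a local superderivation of $L$ that is not a superderivation of $L$.
   Context: A Lie superalgebra over $\mathbb{F}$ is a $\mathbb{Z}_2$-graded vector space $L=L_{\bar 0}\oplus L_{\bar 1}$ with a bilinear bracket satisfying $[L_\alpha,L_\beta]\subseteq L_{\alpha+\beta}$ and, for all $x\in L_\alpha$, $y\in L_\beta$, $z\in L$ with $\alpha,\beta\in\mathbb{Z}_2$ (in the first identity $x,y$ are homogeneous of degrees $|x|=\alpha$, $|y|=\beta$), $[x,y]=-(-1)^{|x||y|}[y,x]$ and $[x,[y,z]]=[[x,y],z]+(-1)^{|x||y|}[y,[x,z]]$. Lower central series: $L^0=L$, $L^1=[L,L]$, $L^k=[L,L^{k-1}]$ for $k\geq 1$. $L$ is nilpotent if $L^n=0$ for some positive integer $n$; the smallest such positive integer $n$ is the nilpotency index, and $L$ is then called $n$-step nilpotent. The center is $Z(L)=\{x\in L\mid [x,y]=0 \text{ for all } y\in L\}$. A linear map $D:L\to L$ that is homogeneous of degree $|D|=\alpha\in\mathbb{Z}_2$ (i.e. $D(L_\beta)\subseteq L_{\alpha+\beta}$) is a superderivation of degree $\alpha$ if $D([x,y])=[D(x),y]+(-1)^{|D||x|}[x,D(y)]$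 for all homogeneous $x\in L$ and all $y\in L$. Let $\operatorname{Der}_\alpha(L)$ be the set of these, and $\operatorname{Der}(L)=\operatorname{Der}_{\bar 0}(L)\oplus\operatorname{Der}_{\bar 1}(L)$; the elements of $\operatorname{Der}(L)$ are the superderivations of $L$. A superderivation $D$ is trivial if $D(x)=0$ for all $x\in L$, and non-trivial otherwise. A linear map $\Delta:L\to L$ is a local superderivation if for every $x\in L$ there is a superderivation $D_x\in\operatorname{Der}(L)$ (depending on $x$) with $\Delta(x)=D_x(x)$. A pure local superderivation is a local superderivation that is not a superderivation. *)

(* Defs.v *)
From HB Require Import structures.
From mathcomp Require Import all_boot all_order all_algebra.
Set Implicit Arguments.
Unset Strict Implicit.
Unset Printing Implicit Defensive.
Import GRing.Theory.
Local Open Scope ring_scope.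

(* The group Z_2 of degrees is [bool] with [addb]; [false] is the even degree. *)
HB.mixin Record Vector_isLieSuperalgebra (F : fieldType) L
    of Vector F L := {
  homog : bool -> {vspace L};
  lie : L -> L -> L;
  homog_direct : directv (homog false + homog true);
  homog_full : (homog false + homog true)%VS = fullv;
  lie_linearl : forall y, linear (lie^~ y);
  lie_linearr : forall x, linear (lie x);
  lie_homog : forall a b x y,
    x \in homog a -> y \in homog b -> lie x y \in homog (a (+) b);
  lie_skew : forall a b x y, x \in homog a -> y \in homog b ->
    lie x y = - ((-1) ^+ (a && b) *: lie y x);
  lie_jacobi : forall a b x y z, x \in homog a -> y \in homog b ->
    lie x (lie y z) = lie (lie x y) z + (-1) ^+ (a && b) *: lie y (lie x z)
}.

#[short(type="lieSuperalgType")]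
HB.structure Definition LieSuperalgebra (F : fieldType) :=
  {L of Vector_isLieSuperalgebra F L & Vector F L}.

Section LieSuperalgebraTheory.
Context {F : fieldType} {L : lieSuperalgType F}.
Implicit Types (U V W : {vspace L}) (D : 'End(L)).

(* The span of all brackets [lie u v] with u in U, v in V: see [liev_subP]. *)
Definition liev U V : {vspace L} :=
  <<[seq lie u v | u <- vbasis U, v <- vbasis V]>>%VS.

Lemma liev_subP U V W :
  reflect (forall u v, u \in U -> v \in V -> lie u v \in W) (liev U V <= W)%VS.
Proof.
apply: (iffP span_subvP) => [sUVW u v Uu Vv | sUVW _ /allpairsP[[u v] /= [Uu Vv ->]]].
  pose lL w := GRing.isLinear.Build F L L *:%R (lie^~ w) (lie_linearl w).
  pose lR w := GRing.isLinear.Build F L L *:%R (lie w) (lie_linearr w).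
  pose fL w : {linear L -> L} := HB.pack (lie^~ w) (lL w).
  pose fR w : {linear L -> L} := HB.pack (lie w) (lR w).
  rewrite (coord_vbasis Uu) -[lie _ v]/(fL v _) linear_sum.
  apply: memv_suml => i _; rewrite linearZ memvZ //= (coord_vbasis Vv).
  rewrite -[lie _ _]/(fR _ _) linear_sum.
  apply: memv_suml => j _; rewrite linearZ memvZ //=.
  by apply/sUVW/allpairs_f; rewrite mem_nth ?size_tuple.
by apply: sUVW; apply: vbasis_mem.
Qed.

Fixpoint lower_central (k : nat) : {vspace L} :=
  if k is k'.+1 then liev fullv (lower_central k') else fullv.

Definition in_center (z : L) : Prop := forall y : L, lie z y = 0.

Definition superder_of_degree (a : bool) D : Prop :=
  (forall b, D @: homog b <= homog (a (+) b))%VS /\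
  (forall b (x y : L), x \in homog b ->
     D (lie x y) = lie (D x) y + (-1) ^+ (a && b) *: lie x (D y)).

Definition superder D : Prop :=
  exists D0 D1 : 'End(L),
    [/\ superder_of_degree false D0, superder_of_degree true D1
      & D = D0 + D1].

Definition trivial_superder D : Prop := forall x : L, D x = 0.

Definition local_superder (Delta : 'End(L)) : Prop :=
  forall x : L, exists2 D : 'End(L), superder D & Delta x = D x.

Definition pure_local_superder (Delta : 'End(L)) : Prop :=
  local_superder Delta /\ ~ superder Delta.

End LieSuperalgebraTheory.

Arguments lower_central {F} L k.

Definition step_nilpotent (F : fieldType) (L : lieSuperalgType F) (n : nat) :
    Prop :=
  [/\ (0 < n)%N, lower_central L n = 0%VS
    & forall m, (0 < m)%N -> lower_central L m = 0%VS -> (n <= m)%N].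

(* Main.v *)
(* Some [u] in [L^{n-3}] does not commute with [L^1], and [D := ad u] sends
   [L^1] into [L^{n-1}], hence into the centre. Let [Delta] agree with [D] on
   [L^1] and vanish on a complement of [L^1]. Any linear map from [L] to its
   centre that kills [L^1] is a superderivation, and outside [L^1] such maps
   take every central value; hence [Delta] is a local superderivation. But
   [Delta] has central values everywhere, and a superderivation with central
   values kills [L^1], whereas [Delta = D] is nonzero there. *)
Require Import Defs.
From HB Require Import structures.
From mathcomp Require Import all_boot all_order all_algebra.

Set Implicit Arguments.
Unset Strict Implicit.
Unset Printing Implicit Defensive.
Import GRing.Theory.
Local Open Scope ring_scope.

HB.instance Definition _ (F : fieldType) (L : lieSuperalgType F) (x : L) :=
  GRing.isLinear.Build F L L *:%R (lie x) (lie_linearr x).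

(** The map [q] projects along [U], so [q x] is nonzero when [x] lies outside [U]. Taking the
    coordinate of [q v] along [q x], times [t], gives [f]. The last clause keeps all values central
    when [t] is. *)
Lemma exists_separating_End (F : fieldType) (V : vectType F) (U : {vspace V})
    (x t : V) : x \notin U ->
  exists f : 'End(V), [/\ f x = t, forall u, u \in U -> f u = 0
    & forall v, f v \in <[t]>%VS].
Proof.
move=> Ux; pose q : 'End(V) := (\1 - projv U)%VF.
have qx : q x != 0.
  rewrite /q !lfunE /= !lfunE /= subr_eq0; apply: contraNneq Ux => ->.
  exact: memv_proj.
have qU u : u \in U -> q u = 0.
  by move=> Uu; rewrite /q !lfunE /= !lfunE /= projv_id ?subrr.
pose X := [tuple q x]; pose phi v := coord X ord0 (q v) *: t.
have phi_lin : linear phi.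
  by move=> a u v; rewrite /phi !linearP /= scalerDl scalerA.
pose fL := GRing.isLinear.Build F V V *:%R phi phi_lin.
pose f : {linear V -> V} := HB.pack phi fL.
exists (linfun f); split=> [|u Uu|v]; rewrite lfunE /= /phi.
- have := @coord_free _ _ _ X ord0 ord0; rewrite /= seq1_free => -> //.
  by rewrite scale1r.
- by rewrite qU // linear0 scale0r.
- by rewrite memvZ ?memv_line.
Qed.

Section LieSuperalgebraFacts.
Variables (F : fieldType) (L : lieSuperalgType F).
Implicit Types (a b : bool) (x y z u v : L) (f D : 'End(L)).

Lemma lieDl y x x' : lie (x + x') y = lie x y + lie x' y.
Proof. by have := lie_linearl y 1 x x'; rewrite /= !scale1r. Qed.

Lemma lie0l y : lie 0 y = 0.
Proof. by apply: (addIr (lie 0 y)); rewrite -lieDl !add0r. Qed.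

Lemma lieZl y c x : lie (c *: x) y = c *: lie x y.
Proof. by have := lie_linearl y c x 0; rewrite /= lie0l !addr0. Qed.

Definition hproj a : 'End(L) := daddv_pi (homog a) (homog (~~ a)).

Lemma homog_cap a : (homog a :&: homog (~~ a) = 0 :> {vspace L})%VS.
Proof.
have /directv_addP := @homog_direct F L.
by case: a => //=; rewrite capvC.
Qed.

Lemma hproj_mem a x : hproj a x \in homog a.
Proof. exact: memv_pi. Qed.

Lemma hproj_id a x : x \in homog a -> hproj a x = x.
Proof. exact/daddv_pi_id/homog_cap. Qed.

Lemma hproj_sum a x : hproj a x + hproj (~~ a) x = x.
Proof.
rewrite /hproj negbK daddv_pi_add ?homog_cap //.
by case: a => /=; rewrite 1?[(homog true + _)%VS]addvC homog_full memvf.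
Qed.

Lemma hproj_other a x : x \in homog a -> hproj (~~ a) x = 0.
Proof.
by move=> ax; apply: (addrI (hproj a x)); rewrite hproj_sum hproj_id ?addr0.
Qed.

Lemma hproj_homog a b x :
  x \in homog b -> hproj a x = if a == b then x else 0.
Proof.
case: eqP => [->|/eqP ab] bx; first exact: hproj_id.
by have -> : a = ~~ b by [move: ab; case: a b {bx} => [] []]; rewrite hproj_other.
Qed.

Lemma hproj_lie a x y :
  hproj a (lie x y) = lie (hproj false x) (hproj a y)
                    + lie (hproj true x) (hproj (~~ a) y).
Proof.
have -> : lie x y = lie (hproj false x + hproj true x)
                        (hproj a y + hproj (~~ a) y).
  by rewrite (hproj_sum false x) hproj_sum.
rewrite lieDl !linearD /=.
have h b c := hproj_homog a (lie_homog _ _ _ _ (hproj_mem b x) (hproj_mem c y)).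
by rewrite !h; case: a {h} => /=; rewrite ?addr0 ?add0r.
Qed.

(** Each term of the series is a graded subspace. Skew-symmetry and Jacobi hold only for homogeneous
    elements, so later arguments pass to components and must stay inside $L^k$. *)
Lemma lower_central_hproj k a x :
  x \in lower_central L k -> hproj a x \in lower_central L k.
Proof.
elim: k a x => [|k IH] a x; first by rewrite !memvf.
rewrite memv_preim; apply: subvP x; apply/liev_subP => u v _ kv.
rewrite -memv_preim hproj_lie; have /liev_subP h := subvv (lower_central L k.+1).
by rewrite memvD // h ?memvf ?IH.
Qed.

Lemma lie_lower_central k x y :
  y \in lower_central L k -> lie x y \in lower_central L k.+1.
Proof.
by move=> ky; have /liev_subP h := subvv (lower_central L k.+1); rewrite h ?memvf.
Qed.

(** The series is built by bracketing on the left; skew-symmetry, applied to components, moves $L^k$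
    to the other side. *)
Lemma lower_central_lie k x y :
  x \in lower_central L k -> lie x y \in lower_central L k.+1.
Proof.
move=> kx; rewrite -(hproj_sum false x) -(hproj_sum false y) lieDl !linearD /=.
have h a b : lie (hproj a x) (hproj b y) \in lower_central L k.+1.
  rewrite (lie_skew _ _ _ _ (hproj_mem a x) (hproj_mem b y)) memvN memvZ //.
  by rewrite lie_lower_central ?lower_central_hproj.
by rewrite !memvD.
Qed.

(** Jacobi writes $[u,[x,y]]$ as $[[u,x],y] \pm [x,[u,y]]$, and each term brackets [u] twice with
    elements of $L$. *)
Lemma lie_lower_central_1 k u v : u \in lower_central L k ->
  v \in lower_central L 1 -> lie u v \in lower_central L k.+2.
Proof.
move=> ku.
suff h a b u' x y : u' \in homog a -> x \in homog b ->
    u' \in lower_central L k -> lie u' (lie x y) \in lower_central L k.+2.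
  (* The preimage under [lie u] is a subspace, so it is enough to test the brackets spanning
     $L^1$. *)
  suff /subvP s : (lower_central L 1 <= linfun (lie u) @^-1: lower_central L k.+2)%VS.
    by move=> /s; rewrite -memv_preim lfunE.
  apply/liev_subP => x y _ _; rewrite -memv_preim lfunE /=.
  rewrite -(hproj_sum false u) -(hproj_sum false x) !lieDl !linearD /=.
  by rewrite !memvD // (h _ _ _ _ _ (hproj_mem _ _) (hproj_mem _ _))
             ?lower_central_hproj.
move=> au bx ku'; rewrite (lie_jacobi _ _ _ _ _ au bx) memvD ?memvZ //.
  by rewrite !lower_central_lie.
by rewrite lie_lower_central ?lower_central_lie.
Qed.

(** For $y$ of degree $b$, the bracket of $y$ with the degree $a$ part of $z$ is the degree $a+b$
    component of $[z,y]=0$. *)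
Lemma in_center_hproj a z : in_center z -> in_center (hproj a z).
Proof.
move=> cz y.
have cb b : lie (hproj a z) (hproj b y) = 0.
  have := hproj_lie (a (+) b) z (hproj b y); rewrite cz linear0.
  rewrite !(hproj_homog _ (hproj_mem b y)).
  by case: a b => [] [] /=; rewrite ?linear0 ?addr0 ?add0r.
by rewrite -(hproj_sum false y) linearD /= !cb addr0.
Qed.

Lemma lie_in_center x z : in_center z -> lie x z = 0.
Proof.
move=> cz; have h a b : lie (hproj a x) (hproj b z) = 0.
  rewrite (lie_skew _ _ _ _ (hproj_mem a x) (hproj_mem b z)) in_center_hproj //.
  by rewrite scaler0 oppr0.
by rewrite -(hproj_sum false x) -(hproj_sum false z) lieDl !linearD /= !h !addr0.
Qed.

Lemma in_centerD z z' : in_center z -> in_center z' -> in_center (z + z').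
Proof. by move=> cz cz' y; rewrite lieDl cz cz' addr0. Qed.

(** For each homogeneous component of [x], the Leibniz rule is the Jacobi identity. *)
Lemma superder_ad x : superder (linfun (lie x)).
Proof.
have h a : superder_of_degree a (linfun (lie (hproj a x))).
  split=> [b|b y z by_].
    apply/subvP => _ /memv_imgP[y by_ ->].
    by rewrite lfunE lie_homog ?hproj_mem.
  by rewrite !lfunE /= (lie_jacobi _ _ _ _ _ (hproj_mem a x) by_).
exists (linfun (lie (hproj false x))), (linfun (lie (hproj true x))).
split=> //; apply/lfunP => y; rewrite !lfunE /= !lfunE /= -lieDl.
by rewrite hproj_sum.
Qed.

(** The component of [f] of degree [a] in the $\mathbb{Z}_2$-grading of the endomorphisms. *)
Definition degree_part a f : 'End(L) :=
  ((hproj a \o f \o hproj false) + (hproj (~~ a) \o f \o hproj true))%VF.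

Lemma degree_partE a f x : degree_part a f x =
  hproj a (f (hproj false x)) + hproj (~~ a) (f (hproj true x)).
Proof. by rewrite /degree_part add_lfunE !comp_lfunE. Qed.

(** Both sides of the Leibniz rule vanish. The two degree parts of [f] inherit the hypotheses
    because the centre and $L^1$ are graded. *)
Lemma superder_central f : (forall x, in_center (f x)) ->
  (forall x, x \in lower_central L 1 -> f x = 0) -> superder f.
Proof.
move=> fc f1; have h a : superder_of_degree a (degree_part a f).
  split=> [b|b x y _].
    apply/subvP => _ /memv_imgP[x bx ->]; rewrite degree_partE.
    rewrite !(hproj_homog _ bx).
    by case: a b {bx} => [] []; rewrite /= !linear0 ?addr0 ?add0r hproj_mem.
  have c z : in_center (degree_part a f z).
    by rewrite degree_partE; apply: in_centerD; apply: in_center_hproj.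
  rewrite c (lie_in_center x (c y)) scaler0 addr0 degree_partE.
  have xy : lie x y \in lower_central L 1 by rewrite lie_lower_central ?memvf.
  by rewrite !f1 ?lower_central_hproj // !linear0 addr0.
exists (degree_part false f), (degree_part true f); split=> //.
apply/lfunP => x; rewrite add_lfunE !degree_partE addrACA.
by rewrite !hproj_sum -linearD /= hproj_sum.
Qed.

(** The Leibniz rule kills brackets once [D0] and [D1] are separately central-valued. On homogeneous
    [x] their values have opposite degrees, hence are the components of the central element
    [D x]. *)
Lemma superder_in_center_eq0 D : superder D -> (forall x, in_center (D x)) ->
  forall x, x \in lower_central L 1 -> D x = 0.
Proof.
case=> D0 [D1 [[h0 d0] [h1 d1] ->]] c.
have c01 b x : x \in homog b -> in_center (D0 x) /\ in_center (D1 x).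
  move=> bx.
  have m0 : D0 x \in homog b by apply: (subvP (h0 b)); rewrite memv_img.
  have m1 : D1 x \in homog (~~ b) by apply: (subvP (h1 b)); rewrite memv_img.
  have cx := c x; rewrite lfunE /= in cx; split.
    have := in_center_hproj b cx; rewrite linearD /= hproj_id //.
    by have := hproj_other m1; rewrite negbK => ->; rewrite addr0.
  have := in_center_hproj (~~ b) cx.
  by rewrite linearD /= hproj_other // hproj_id // add0r.
have cc x : in_center (D0 x) /\ in_center (D1 x).
  have [p0 p1] := c01 _ _ (hproj_mem false x).
  have [q0 q1] := c01 _ _ (hproj_mem true x).
  by rewrite -(hproj_sum false x) !linearD; split; apply: in_centerD.
have z b x y : x \in homog b -> (D0 + D1)%VF (lie x y) = 0.
  move=> bx; rewrite lfunE /= (d0 _ _ _ bx) (d1 _ _ _ bx).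
  have [x0 x1] := cc x; have [y0 y1] := cc y.
  by rewrite x0 x1 (lie_in_center x y0) (lie_in_center x y1) !scaler0 !addr0.
suff /subvP s : (lower_central L 1 <= lker (D0 + D1)%R)%VS.
  by move=> x /s; rewrite memv_ker => /eqP.
apply/liev_subP => x y _ _; rewrite memv_ker -(hproj_sum false x) lieDl linearD /=.
by rewrite !(z _ _ _ (hproj_mem _ _)) addr0.
Qed.

Lemma exists_pure_local_superder D v : superder D ->
  (forall x, x \in lower_central L 1 -> in_center (D x)) ->
  v \in lower_central L 1 -> D v <> 0 ->
  exists Delta : 'End(L), pure_local_superder Delta.
Proof.
move=> sD cD v1 Dv; pose U := lower_central L 1.
pose Delta : 'End(L) := (D \o projv U)%VF.
have cDelta x : in_center (Delta x).
  by rewrite /Delta lfunE /=; apply: cD; apply: memv_proj.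
have DeltaU x : x \in U -> Delta x = D x by move=> ?; rewrite lfunE /= projv_id.
exists Delta; split=> [x|sDelta]; last first.
  by apply: Dv; rewrite -DeltaU //; apply: superder_in_center_eq0.
have [xU|xU] := boolP (x \in U); first by exists D; rewrite ?DeltaU.
(* Off $L^1$, the witness at [x] kills $L^1$ and takes values on the line of the central vector
   [Delta x]. *)
have [f [fx fU ft]] := exists_separating_End (Delta x) xU.
exists f => //; apply: superder_central => // y.
by have /vlineP[c ->] := ft y => z; rewrite lieZl cDelta scaler0.
Qed.

End LieSuperalgebraFacts.

Theorem theorem4p4 (F : fieldType) (L : lieSuperalgType F) (n : nat)
    (hn : (3 < n)%N) (hL : step_nilpotent L n)
    (hbr : liev (lower_central L (n - 3)) (lower_central L 1) <> 0%VS) :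
  (exists D : 'End(L),
     [/\ superder D, ~ trivial_superder D
       & forall x : L, x \in lower_central L 1 -> in_center (D x)]) /\
  (exists Delta : 'End(L), pure_local_superder Delta).
Proof.
set A := lower_central L (n - 3) in hbr *; set B := lower_central L 1 in hbr *.
(* A nonzero span has a nonzero generator, which gives explicit basis vectors [u] and [v] with
   $[u,v]\neq 0$. *)
have [/allP s0|/allPn[_ /allpairsP[[u v] /= [/vbasis_mem ku /vbasis_mem v1 ->]]]] :=
    boolP (all (pred1 0) [seq lie u v | u <- vbasis A, v <- vbasis B]).
  case: hbr; apply/eqP; rewrite -subv0; apply/span_subvP => w /s0 /eqP ->.
  exact: mem0v.
move=> /eqP uv.
have sD := superder_ad u.
have cD x : x \in lower_central L 1 -> in_center (linfun (lie u) x).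
  move=> x1 y; apply/eqP; rewrite -memv0 lfunE /=; case: hL => _ <- _.
  (* Bracketing [u] with $L^1$ raises the index $n-3$ by two, and the further bracket with [y]
     reaches $L^n=0$. *)
  have -> : n = (n - 3).+3 by rewrite -addn3 subnK // ltnW.
  by rewrite lower_central_lie ?lie_lower_central_1.
have Dv : linfun (lie u) v <> 0 by rewrite lfunE.
split; last exact: exists_pure_local_superder sD cD v1 Dv.
by exists (linfun (lie u)); split=> // /(_ v).
Qed.
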